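(* Let $H$ be a separable complex Hilbert space, $T\in\mathcal{B}(H)$, $A\in\mathcal{B}(H)^+$, and let $m,n$ be nonnegative integers. Then the following hold. (1) If $T$ is invertible, then $T$ is $(A;(m,n))$-isosymmetric (resp. skew $(A;(m,n))$-isosymmetric) if and only if $T^{-1}$ is $(A;(m,n))$-isosymmetric (resp. skew $(A;(m,n))$-isosymmetric). (2) If $T$ is $(A;(m,n))$-isosymmetric, then $T^k$ is $(A;(m,n))$-isosymmetric for every $k\in\mathbb{N}$. (3) If $T$ is skew $(A;(m,n))$-isosymmetric, then $T^k$ is skew $(A;(m,n))$-isosymmetric for every odd $k\in\mathbb{N}$.
   Context: $\mathcal{B}(H)$ is the algebra of bounded linear operators on $H$ and $\mathcal{B}(H)^+$ the set of positive (semi-definite) operators. For $A,T\in\mathcal{B}(H)$ and nonnegative integers $m,n$ put $$\mathcal{S}^n_A(T)=\sum_{k=0}^n(-1)^{n-k}\binom nk T^{*k}AT^{n-k},\qquad \zeta^n_A(T)=\sum_{k=0}^n\binom nk T^{*k}AT^{n-k},$$ $$\Omega_A^{m,n}(T)=\sum_{j=0}^m(-1)^{m-j}\binom mj T^{*j}\mathcal{S}^n_A(T)T^j,\qquad \Lambda_A^{m,n}(T)=\sum_{j=0}^m(-1)^{m-j}\binom mj T^{*j}\zeta^n_A(T)T^j.$$ $T$ is $(A;(m,n))$-isosymmetric if $\Omega_A^{m,n}(T)=0$, and skew $(A;(m,n))$-isosymmetric if $\Lambda_A^{m,n}(T)=0$. *)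

(* Defs.v *)
From HB Require Import structures.
From mathcomp Require Import all_boot all_order all_algebra.
From mathcomp Require Import complex.
From mathcomp Require Import boolp classical_sets functions cardinality.
From mathcomp Require Import reals interval_inference.
From mathcomp Require Import topology normedtype.
From mathcomp Require Import ring lra.
Set Implicit Arguments.
Unset Strict Implicit.
Unset Printing Implicit Defensive.

Import Order.TTheory GRing.Theory Num.Theory.
Import numFieldNormedType.Exports.

Local Open Scope classical_set_scope.
Local Open Scope ring_scope.

(* The inner product is linear in its first argument.  Norms over R[i] take
   values in R[i], where x <= y means that y - x is a nonnegative real. *)
HB.mixin Record NormedModule_isHilbert (R : realType) H
    of CompleteNormedModule R[i] H := {
  inner : {dot H for (@Num.conj R[i])} ;
  innerE : forall x : H, inner x x = `|x| ^+ 2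
}.

#[short(type="hilbertType")]
HB.structure Definition Hilbert (R : realType) :=
  { H of CompleteNormedModule R[i] H & NormedModule_isHilbert R H }.

Definition separable_space (T : topologicalType) : Prop :=
  exists2 D : set T, countable D & dense D.

Section BoundedOperators.
Context {R : realType} {H : hilbertType R}.

Definition bounded_operator (f : H -> H) : Prop :=
  linear f /\ exists M : R[i], forall x, `|f x| <= M * `|x|.

Definition bop_pred : {pred H -> H} := fun f => `[< bounded_operator f >].

Lemma bop_predP f : reflect (bounded_operator f) (f \in bop_pred).
Proof. exact: asboolP. Qed.

Lemma bop_pred_zmod_closed : zmod_closed bop_pred.
Proof.
split=> [|f g /bop_predP[lf [M fM]] /bop_predP[lg [N gN]]]; apply/bop_predP.
  split=> [a x y /=|]; first by rewrite /GRing.zero/= scaler0 addr0.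
  by exists 0 => x; rewrite mul0r normr0.
split=> [a x y /=|].
  change (f (a *: x + y) - g (a *: x + y) = a *: (f x - g x) + (f y - g y)).
  by rewrite lf lg opprD addrACA -scalerBr.
exists (M + N) => x; rewrite mulrDl; change (`|f x - g x| <= M * `|x| + N * `|x|).
exact: le_trans (ler_normB _ _) (lerD (fM x) (gN x)).
Qed.

HB.instance Definition _ :=
  GRing.isZmodClosed.Build (H -> H) bop_pred bop_pred_zmod_closed.

End BoundedOperators.

(* B(H), made below into a ring with composition as multiplication; it is
   possibly trivial (H = 0), hence only a pzRingType. *)
Record bop (R : realType) (H : hilbertType R) :=
  Bop { bop_fun :> H -> H ; bop_funP : bop_fun \in bop_pred }.

Section BopRing.
Context {R : realType} {H : hilbertType R}.
HB.instance Definition _ := [isSub for @bop_fun R H].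
HB.instance Definition _ := [Choice of bop H by <:].
HB.instance Definition _ := [SubChoice_isSubZmodule of bop H by <:].

Implicit Types A S T U : bop H.

Lemma bopP S T : S =1 T -> S = T.
Proof. by move=> ST; apply/val_inj/funext. Qed.

Lemma bop_linear T : linear T.
Proof. by case/bop_predP: (bop_funP T). Qed.

Lemma bound_normr (M a b : R[i]) :
  0 <= a -> 0 <= b -> b <= M * a -> b <= `|M| * a.
Proof.
rewrite le_eqVlt => /predU1P[<-|a0] b0 bMa; first by move: bMa; rewrite !mulr0.
have M0 : 0 <= M by rewrite -(pmulr_lge0 M a0) (le_trans b0).
by rewrite ger0_norm.
Qed.

Lemma bop_bounded T :
  exists2 M : R[i], 0 <= M & forall x, `|T x| <= M * `|x|.
Proof.
case/bop_predP: (bop_funP T) => _ [M TM].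
by exists `|M| => // x; exact: bound_normr.
Qed.

Lemma bop0E x : (0 : bop H) x = 0. Proof. by []. Qed.
Lemma bopDE S T x : (S + T) x = S x + T x. Proof. by []. Qed.
Lemma bopNE T x : (- T) x = - T x. Proof. by []. Qed.

HB.instance Definition _ T := GRing.isLinear.Build R[i] H H *:%R T (bop_linear T).

Fact bop_id_subproof : (idfun : H -> H) \in bop_pred.
Proof. by apply/bop_predP; split=> //; exists 1 => x; rewrite mul1r. Qed.

Fact bop_comp_subproof S T : (S \o T : H -> H) \in bop_pred.
Proof.
apply/bop_predP; split=> [a x y /=|]; first by rewrite !linearP.
have [[M M0 SM] [N _ TN]] := (bop_bounded S, bop_bounded T).
exists (M * N) => x /=; rewrite -mulrA.
by rewrite (le_trans (SM _))// ler_wpM2l.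
Qed.

Definition bop_one := Bop bop_id_subproof.
Definition bop_mul S T := Bop (bop_comp_subproof S T).
Fact bop_mulA : associative bop_mul.
Proof. by move=> S T U; apply: bopP. Qed.
Fact bop_mul1l : left_id bop_one bop_mul.
Proof. by move=> S; apply: bopP. Qed.
Fact bop_mul1r : right_id bop_one bop_mul.
Proof. by move=> S; apply: bopP. Qed.
Fact bop_mulDl : left_distributive bop_mul +%R.
Proof. by move=> S T U; apply: bopP. Qed.
Fact bop_mulDr : right_distributive bop_mul +%R.
Proof. by move=> S T U; apply: bopP => x; rewrite bopDE/= linearD. Qed.

HB.instance Definition _ := GRing.Zmodule_isPzRing.Build (bop H)
  bop_mulA bop_mul1l bop_mul1r bop_mulDl bop_mulDr.

Lemma bop1E x : (1 : bop H) x = x. Proof. by []. Qed.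
Lemma bopME S T x : (S * T) x = S (T x). Proof. by []. Qed.

Local Notation "''[' u , v ]" := (inner u v).

Lemma inner_CauchySchwarz (x y : H) : `|'[x, y]| <= `|x| * `|y|.
Proof.
have [->|y0] := eqVneq y 0; first by rewrite linear0r !normr0 mulr0.
rewrite -(@ler_pXn2r _ 2)// ?nnegrE ?mulr_ge0// exprMn -!innerE.
have yy : 0 < '[y, y] by rewrite dnorm_gt0.
have := dnorm_ge0 inner ('[y, y] *: x - '[x, y] *: y).
rewrite dnormB /= !dnormZ linearZl_LR/= linearZr_LR/= (gtr0_norm yy).
set a := '[x, y]; set b := '[x, x]; set c := '[y, y].
rewrite -/c in yy; have cR : c^* = c by rewrite geC0_conj// ltW.
rewrite !rmorphM/= conjCK cR normCK => h.
have {h} : 0 <= c * (b * c - a * a^*) by move: h; congr (_ <= _); ring.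
by rewrite pmulr_rge0// subr_ge0.
Qed.

Lemma real_complexK (z : R[i]) : z \is Num.real -> z = (complex.Re z)%:C%C.
Proof. by move/RRe_real. Qed.

Section Riesz.
Context (f : H -> R[i]) (M : R[i])
  (f_lin : forall a x y, f (a *: x + y) = a * f x + f y)
  (f_bnd : forall x, `|f x| <= M * `|x|).

Let f0 : f 0 = 0.
Proof. by have := f_lin (-1) 0 0; rewrite scaler0 addr0 mulN1r addNr. Qed.
Let fZ a x : f (a *: x) = a * f x.
Proof. by rewrite -[in LHS](addr0 (a *: x)) f_lin f0 addr0. Qed.
Let fD x y : f (x + y) = f x + f y.
Proof. by rewrite -[in LHS](scale1r x) f_lin mul1r. Qed.

Let F x : R[i] := '[x, x] - f x - (f x)^*.

Lemma riesz_near_min_le x (d : R[i]) : 0 <= d ->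
   (forall y, F x <= F y + d ^+ 2) ->
  forall h, `|'[h, x] - f h| <= d * `|h|.
Proof.
move=> d0 Fd h.
have [->|h0] := eqVneq h 0.
  by rewrite linear0l f0 subrr normr0 mulr_ge0.
have hh : 0 < '[h, h] by rewrite dnorm_gt0.
move: ('[h, x] - f h) (esym (subrK (f h) '[h, x])) => c cE.
rewrite -(@ler_pXn2r _ 2)// ?nnegrE ?mulr_ge0// exprMn -innerE.
have := Fd (x + (- (c^* / '[h,h])) *: h).
rewrite /F dnormD dnormZ linearZr_LR/= fD fZ.
have -> : '[x, h] = '[h, x]^* by rewrite hermC /= mul1r.
have hR : '[h, h]^* = '[h, h] by rewrite geC0_conj// ltW.
rewrite cE normrN normrM normfV (gtr0_norm hh) norm_conjC.
rewrite exprMn !normCK.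
rewrite !(rmorphD, rmorphN, rmorphM, fmorphV)/= !conjCK hR.
set b := '[h, h] in hh hR *.
move=> le0; rewrite -subr_ge0 in le0; rewrite -subr_ge0.
suff : 0 <= (d ^+ 2 * b - c * c^*) / b by rewrite pmulr_lge0// invr_gt0.
move: le0; congr (_ <= _); field.
by rewrite gt_eqF.
Qed.

Lemma riesz_near_min (d : R[i]) : 0 < d -> exists x, forall y, F x <= F y + d.
Proof.
move=> d0.
have FR x : F x = (complex.Re (F x))%:C%C.
  apply: real_complexK; rewrite CrealE /F !rmorphB/= conjCK geC0_conj// ?dnorm_ge0//.
  by apply/eqP; ring.
have dR : d = (complex.Re d)%:C%C by apply: real_complexK; rewrite gtr0_real.
pose E := [set complex.Re (F x) | x in [set: H]].
have lbE : has_inf E.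
  split; first by exists (complex.Re (F 0)), 0.
  exists (- complex.Re (`|M| ^+ 2)) => _ [x _ <-].
  have MR : `|M| ^+ 2 = (complex.Re (`|M| ^+ 2))%:C%C.
    by apply: real_complexK; rewrite realX.
  rewrite -lecR -FR (_ : (- _)%:C%C = - `|M| ^+ 2); last first.
    by rewrite [in RHS]MR rmorphN.
  have M0 : `|f x| <= `|M| * `|x|.
    exact: bound_normr.
  have h : f x + (f x)^* <= 2 * (`|M| * `|x|).
    apply: le_trans (_ : 2 * `|f x| <= _); last by rewrite ler_wpM2l.
    rewrite mulr_natl mulr2n -[X in _ <= _ + X]norm_conjC.
    apply: le_trans (ler_normD _ _).
    rewrite real_ler_norm// CrealE rmorphD/= conjCK addrC//.
  rewrite /F innerE -subr_ge0.
  have : 0 <= (`|x| - `|M|) ^+ 2 by rewrite real_exprn_even_ge0// realB.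
  move: h; rewrite -subr_ge0 => h1 h2; have := addr_ge0 h1 h2.
  congr (_ <= _); ring.
have d'0 : 0 < complex.Re d by rewrite -ltcR -dR.
have [_ [x _ <-] Fx] := inf_adherent d'0 lbE.
exists x => y; rewrite FR (FR y) dR -rmorphD/= lecR.
apply: le_trans (ltW Fx) _; rewrite lerD2r.
by apply: ge_inf; [case: lbE | exists y].
Qed.

Lemma riesz : exists z, forall h, f h = '[h, z].
Proof.
pose d n : R[i] := n.+1%:R^-1.
have d0 n : 0 < d n by rewrite invr_gt0.
have /choice[u uP] : forall n, exists x, forall h, `|'[h, x] - f h| <= d n * `|h|.
  move=> n; have [x xP] := riesz_near_min (exprn_gt0 2 (d0 n)).
  by exists x; apply: riesz_near_min_le => //; exact: ltW.
have dcvg e : 0 < e -> \forall n \near \oo, d n < e.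
  move=> e0.
  have eR : e = (complex.Re e)%:C%C by apply: real_complexK; rewrite gtr0_real.
  have e'0 : 0 < complex.Re e by rewrite -ltcR -eR.
  near=> n.
  rewrite /d eR -(rmorph_nat (real_complex R)) -fmorphV ltcR.
  near: n; exact: near_infty_natSinv_lt (PosNum e'0).
have ucvg : cvg (u @ \oo).
  apply: cauchy_cvg; apply: cauchy_exP => e e0.
  have e20 : 0 < e / 2 by rewrite divr_gt0.
  have [N _ dN] := dcvg _ e20.
  exists (u N); exists N => // n /= Nn; rewrite -ball_normE/=.
  have [->|uNn] := eqVneq (u N) (u n); first by rewrite subrr normr0.
  set w := u N - u n.
  have w0 : 0 < `|w| by rewrite normr_gt0 subr_eq0.
  have wE : `|w| ^+ 2 = ('[w, u N] - f w) - ('[w, u n] - f w).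
    rewrite -innerE; transitivity ('[w, u N - u n]); first by [].
    by rewrite linearBr; ring.
  have : `|('[w, u N] - f w) - ('[w, u n] - f w)| <= (d N + d n) * `|w|.
    by rewrite mulrDl (le_trans (ler_normB _ _))// lerD//.
  rewrite -wE.
  rewrite ger0_norm// expr2 ler_pM2r// => /le_lt_trans; apply.
  by rewrite [ltRHS](splitr e) ltrD//; apply: dN => //=.
exists (lim (u @ \oo)) => h; apply/eqP; rewrite eq_sym -subr_eq0 -normr_eq0.
set z := lim _.
have zP e : 0 < e -> `|'[h, z] - f h| <= e * (`|h| + `|h|).
  move=> e0.
  near \oo => n.
  have -> : '[h, z] - f h = '[h, z - u n] + ('[h, u n] - f h).
    by rewrite linearBr; ring.
  rewrite mulrDr (le_trans (ler_normD _ _))// lerD//.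
    rewrite (le_trans (inner_CauchySchwarz _ _))// mulrC ler_wpM2r//.
    near: n; apply: cvgr_dist_le => //.
  rewrite (le_trans (uP _ _))// ler_wpM2r//.
  by near: n; near=> n; apply/ltW; near: n; exact: dcvg.
set a := `|_| in zP *; set k := `|h| + `|h| in zP.
have k0 : 0 <= k by rewrite addr_ge0.
apply: contraT => an0; have a0 : 0 < a by rewrite lt_def an0 normr_ge0.
have := zP (a / (k + 1)) _; rewrite divr_gt0// ?ltr_wpDl// => /(_ isT).
rewrite mulrAC ler_pdivlMr ?ltr_wpDl// mulrDr mulr1 gerDl.
by move=> /(lt_le_trans a0); rewrite ltxx.
Unshelve. all: by end_near. Qed.

End Riesz.

Definition is_adjoint S T : Prop := forall x y, '[T x, y] = '[x, S y].

Lemma adjoint_exists T : exists S, is_adjoint S T.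
Proof.
have [M M0 TM] := bop_bounded T.
have /choice[S SP] : forall y, exists z, forall x, '[T x, y] = '[x, z].
  move=> y; apply: (@riesz (fun x => '[T x, y]) (M * `|y|)) => [a u v|x].
    by rewrite linearP linearPl.
  rewrite (le_trans (inner_CauchySchwarz _ _))// mulrAC ler_wpM2r//.
have Slin : linear S.
  move=> a u v; apply/eqP; rewrite -subr_eq0 -(dnorm_eq0 inner); apply/eqP.
  set w := (X in '[X, _]).
  transitivity ('[w, S (a *: u + v) - (a *: S u + S v)]); first by [].
  rewrite linearBr linearDr linearZr_LR/= -!SP linearDr linearZr_LR/=.
  by rewrite subrr.
have Sbnd x : `|S x| <= M * `|x|.
  have [->|Sx0] := eqVneq (S x) 0; first by rewrite normr0 mulr_ge0.
  have Sx : 0 < `|S x| by rewrite normr_gt0.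
  rewrite -(ler_pM2r Sx) -expr2 -innerE -SP.
  rewrite -[leLHS]ger0_norm; last by rewrite SP dnorm_ge0.
  rewrite (le_trans (inner_CauchySchwarz _ _))// mulrAC ler_wpM2r//.
have Sb : S \in bop_pred.
  by apply/bop_predP; split => //; exists M.
by exists (Bop Sb) => x y; exact: SP.
Qed.

Definition adjoint T : bop H := xget 0 [set S | is_adjoint S T].

Lemma adjointP T : is_adjoint (adjoint T) T.
Proof. exact: (xgetPex 0 (adjoint_exists T)). Qed.

Lemma adjoint_unique S T : is_adjoint S T -> S = adjoint T.
Proof.
move=> ST; apply: bopP => y; apply/eqP.
rewrite -subr_eq0 -(dnorm_eq0 inner) linearBr /=.
by rewrite -ST -(adjointP T) subrr.
Qed.

Definition positive_operator A : Prop := forall x, 0 <= '[A x, x].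

Definition is_inverse T S : Prop := T * S = 1 /\ S * T = 1.

(* An integer coefficient (-1) ^ i * 'C(n, k) is written with the ring element
   (-1) ^+ i of B(H) and the natural multiple _ *+ 'C(n, k). *)
Definition symm_sum n A T : bop H :=
  \sum_(k < n.+1)
    (-1) ^+ (n - k) * (adjoint T ^+ k * A * T ^+ (n - k)) *+ 'C(n, k).

Definition skew_symm_sum n A T : bop H :=
  \sum_(k < n.+1) (adjoint T ^+ k * A * T ^+ (n - k)) *+ 'C(n, k).

Definition isosymm_sum m n A T : bop H :=
  \sum_(j < m.+1)
    (-1) ^+ (m - j) * (adjoint T ^+ j * symm_sum n A T * T ^+ j) *+ 'C(m, j).

Definition skew_isosymm_sum m n A T : bop H :=
  \sum_(j < m.+1)
    (-1) ^+ (m - j) * (adjoint T ^+ j * skew_symm_sum n A T * T ^+ j)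
      *+ 'C(m, j).

Definition isosymmetric A m n T : Prop := isosymm_sum m n A T = 0.

Definition skew_isosymmetric A m n T : Prop := skew_isosymm_sum m n A T = 0.

End BopRing.

(* Main.v *)
From HB Require Import structures.
Require Import Defs.
From mathcomp Require Import all_boot all_order all_algebra.
From mathcomp Require Import boolp functions.
From mathcomp Require Import reals topology normedtype.
Set Implicit Arguments.
Unset Strict Implicit.
Unset Printing Implicit Defensive.
Import GRing.Theory Num.Theory.
Local Open Scope ring_scope.

(** Let l and r be the operations X |-> T^* X and X |-> X T on B(H).  They
    commute, so the binomial formula in the ring of additive endomorphisms of
    B(H) turns the two operator sums into

      Omega(A) = (l r - 1)^m (l - r)^n A,  Lambda(A) = (l r - 1)^m (l + r)^n A

    ([isosymm_sumE], [skew_isosymm_sumE]).  Replacing T by its inverse or by a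
    power replaces l and r by their inverses or powers, since T |-> T^*
    reverses products.  In both cases the new factors are multiples of the old
    ones:

      l^-1 r^-1 - 1 = - (l r)^-1 (l r - 1),
      l^-1 - r^-1 = - (l r)^-1 (l - r),   l^-1 + r^-1 = (l r)^-1 (l + r),
      (l r)^k - 1 = (1 + l r + ... + (l r)^(k-1)) (l r - 1),

    while l^k - r^k is a multiple of l - r, and l^k + r^k a multiple of l + r
    for odd k.  All cofactors are built from l, r and their inverses, hence
    commute with the factors, so the new product is a multiple of the old one
    and kills A as soon as the old one does ([defect_factor]).  The identities
    above are proved in [defect_inv] and [defect_exp]; a boolean s, through the
    sign (-1)^s, treats the symmetric (s = false) and skew (s = true) cases
    together. *)

(** * The ring of additive endomorphisms of an abelian group *)

Section AdditiveEndomorphisms.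
Variable V : zmodType.

Definition addEnd_pred : {pred V -> V} :=
  fun f => `[< {morph f : x y / x + y} >].

Fact addEnd_pred_zmod_closed : zmod_closed addEnd_pred.
Proof.
split=> [|f g /asboolP fD /asboolP gD]; apply/asboolP => x y.
  by rewrite /GRing.zero /= addr0.
change (f (x + y) - g (x + y) = (f x - g x) + (f y - g y)).
by rewrite fD gD opprD addrACA.
Qed.

HB.instance Definition _ :=
  GRing.isZmodClosed.Build (V -> V) addEnd_pred addEnd_pred_zmod_closed.

Record addEnd := AddEnd { addEnd_fun :> V -> V; _ : addEnd_fun \in addEnd_pred }.

HB.instance Definition _ := [isSub for addEnd_fun].
HB.instance Definition _ := [Choice of addEnd by <:].
HB.instance Definition _ := [SubChoice_isSubZmodule of addEnd by <:].

Implicit Types f g h : addEnd.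

Lemma addEndP f g : f =1 g -> f = g.
Proof. by move=> fg; apply/val_inj/funext. Qed.

Lemma addEndD f : {morph f : x y / x + y}.
Proof. by case: f => f /= /asboolP. Qed.

Lemma addEnd0 f : f 0 = 0.
Proof. by apply: (addrI (f 0)); rewrite -addEndD !addr0. Qed.

Fact addEnd_id_subproof : (idfun : V -> V) \in addEnd_pred.
Proof. exact/asboolP. Qed.

Fact addEnd_comp_subproof f g : (f \o g : V -> V) \in addEnd_pred.
Proof. by apply/asboolP => x y /=; rewrite !addEndD. Qed.

Definition addEnd_one := AddEnd addEnd_id_subproof.
Definition addEnd_mul f g := AddEnd (addEnd_comp_subproof f g).

Fact addEnd_mulA : associative addEnd_mul.
Proof. by move=> f g h; apply: addEndP. Qed.
Fact addEnd_mul1l : left_id addEnd_one addEnd_mul.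
Proof. by move=> f; apply: addEndP. Qed.
Fact addEnd_mul1r : right_id addEnd_one addEnd_mul.
Proof. by move=> f; apply: addEndP. Qed.
Fact addEnd_mulDl : left_distributive addEnd_mul +%R.
Proof. by move=> f g h; apply: addEndP. Qed.
Fact addEnd_mulDr : right_distributive addEnd_mul +%R.
Proof. by move=> f g h; apply: addEndP => x; exact: addEndD. Qed.

HB.instance Definition _ := GRing.Zmodule_isPzRing.Build addEnd
  addEnd_mulA addEnd_mul1l addEnd_mul1r addEnd_mulDl addEnd_mulDr.

Lemma addEndM f g x : (f * g) x = f (g x).
Proof. by []. Qed.

Lemma addEnd_sum (I : Type) (r : seq I) (F : I -> addEnd) x :
  (\sum_(i <- r) F i) x = \sum_(i <- r) F i x.
Proof.
by elim: r => [|i r IHr]; rewrite ?big_nil // !big_cons -IHr.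
Qed.

Lemma addEndMn f k x : (f *+ k) x = f x *+ k.
Proof. by elim: k => [|k IHk]; rewrite ?mulr0n // !mulrS -IHk. Qed.

End AdditiveEndomorphisms.

(** * Products of commuting left and right multiplications *)

Section DefectOperators.
Variable B : pzRingType.
Implicit Types (S T A : B) (s : bool) (m n k : nat).

Fact lmul_subproof S : ( *%R S : B -> B) \in @addEnd_pred B.
Proof. by apply/asboolP => x y; rewrite mulrDr. Qed.
Definition lmul S : addEnd B := AddEnd (lmul_subproof S).

Fact rmul_subproof T : ( *%R^~ T : B -> B) \in @addEnd_pred B.
Proof. by apply/asboolP => x y; rewrite mulrDl. Qed.
Definition rmul T : addEnd B := AddEnd (rmul_subproof T).

Lemma lmul1 : lmul 1 = 1.
Proof. by apply: addEndP => x; exact: mul1r. Qed.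

Lemma rmul1 : rmul 1 = 1.
Proof. by apply: addEndP => x; exact: mulr1. Qed.

Lemma lmulM S T : lmul (S * T) = lmul S * lmul T.
Proof. by apply: addEndP => x; rewrite /= mulrA. Qed.

(** Right multiplication reverses products, which is harmless for the powers
    and two-sided inverses used below. *)
Lemma rmulM S T : rmul (S * T) = rmul T * rmul S.
Proof. by apply: addEndP => x; rewrite /= mulrA. Qed.

Lemma lmulX S k : lmul (S ^+ k) = lmul S ^+ k.
Proof. by elim: k => [|k IHk]; rewrite ?lmul1 // !exprS lmulM IHk. Qed.

Lemma rmulX T k : rmul (T ^+ k) = rmul T ^+ k.
Proof. by elim: k => [|k IHk]; rewrite ?rmul1 // exprSr exprS rmulM IHk. Qed.

(** This is the associativity of B; it makes the binomial and geometric sum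
    formulas available for arbitrary S and T. *)
Lemma comm_lmul_rmul S T : GRing.comm (lmul S) (rmul T).
Proof. by apply: addEndP => x; rewrite /= mulrA. Qed.

Lemma addEnd_signM (f : addEnd B) k A : ((-1) ^+ k * f) A = (-1) ^+ k * f A.
Proof.
elim: k => [|k IHk]; first by rewrite !mul1r.
by rewrite !exprS !mulN1r !mulNr -IHk.
Qed.

Definition iso_factor S T : addEnd B := lmul S * rmul T - 1.

Definition sym_factor (s : bool) S T : addEnd B :=
  lmul S - (-1) ^+ s * rmul T.

(** With S the adjoint of T this is A |-> Omega(A) for s = false and
    A |-> Lambda(A) for s = true. *)
Definition defect s m n S T : addEnd B :=
  iso_factor S T ^+ m * sym_factor s S T ^+ n.

(** Commutation lets the cofactors be moved to the left, so that the defect of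
    (S', T') is p^m q^n times that of (S, T). *)
Lemma defect_factor s m n S T S' T' p q A :
  GRing.comm p (lmul S) -> GRing.comm p (rmul T) ->
  GRing.comm q (lmul S) -> GRing.comm q (rmul T) ->
  iso_factor S' T' = p * iso_factor S T ->
  sym_factor s S' T' = q * sym_factor s S T ->
  defect s m n S T A = 0 -> defect s m n S' T' A = 0.
Proof.
move=> pS pT qS qT eqE eqD dA0.
have pE : GRing.comm p (iso_factor S T).
  by apply: commrB; [apply: commrM|apply: commr1].
have qE : GRing.comm q (iso_factor S T).
  by apply: commrB; [apply: commrM|apply: commr1].
have qD : GRing.comm q (sym_factor s S T).
  by apply: commrB => //; apply: commrM => //; apply: commr_sign.
have qnEm : GRing.comm (q ^+ n) (iso_factor S T ^+ m).
  by apply/commrX/commr_sym/commrX/commr_sym.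
have -> : defect s m n S' T' = p ^+ m * q ^+ n * defect s m n S T.
  rewrite /defect eqE eqD !exprMn_comm // -!mulrA; congr (_ * _).
  by rewrite !mulrA qnEm.
by rewrite addEndM dA0 addEnd0.
Qed.

(** Both cofactors are, up to sign, x = (l r)^-1: multiplying l - (-1)^s r by x
    gives r^-1 - (-1)^s l^-1, which is - (-1)^s (l^-1 - (-1)^s r^-1). *)
Lemma defect_inv s m n S T S' T' A :
  S * S' = 1 -> S' * S = 1 -> T * T' = 1 -> T' * T = 1 ->
  defect s m n S T A = 0 -> defect s m n S' T' A = 0.
Proof.
move=> SS' S'S TT' T'T.
have lS : lmul S' * lmul S = 1 by rewrite -lmulM S'S lmul1.
have lS' : lmul S * lmul S' = 1 by rewrite -lmulM SS' lmul1.
have rT : rmul T' * rmul T = 1 by rewrite -rmulM TT' rmul1.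
have rT' : rmul T * rmul T' = 1 by rewrite -rmulM T'T rmul1.
pose x := lmul S' * rmul T'.
have xS : GRing.comm x (lmul S).
  apply/commr_sym/commrM; last exact: comm_lmul_rmul.
  by rewrite /GRing.comm lS lS'.
have xT : GRing.comm x (rmul T).
  apply/commr_sym/commrM; first by apply/commr_sym/comm_lmul_rmul.
  by rewrite /GRing.comm rT rT'.
have comm_sx y : GRing.comm x y -> GRing.comm (- ((-1) ^+ s * x)) y.
  move=> xy; apply/commr_sym/commrN/commrM; first exact: commr_sign.
  exact: commr_sym.
have xlr : x * lmul S = rmul T'.
  by rewrite /x comm_lmul_rmul -mulrA lS mulr1.
have xrl : x * rmul T = lmul S' by rewrite /x -mulrA rT mulr1.
have xE : lmul S' * rmul T' = x by [].
(* Keeps associativity rewrites from breaking up the product x. *)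
clearbody x.
apply: (@defect_factor _ _ _ _ _ _ _ (- x) (- ((-1) ^+ s * x))).
- exact/commr_sym/commrN/commr_sym.
- exact/commr_sym/commrN/commr_sym.
- exact: comm_sx.
- exact: comm_sx.
- by rewrite /iso_factor mulNr mulrBr mulr1 opprB mulrA xlr rT xE.
rewrite /sym_factor mulNr mulrBr opprB -!mulrA xlr; congr (_ - _).
by rewrite (mulrA x) (commr_sign x) -mulrA xrl mulrA -expr2 sqrr_sign mul1r.
Qed.

(** The cofactors are geometric sums.  The parity condition ensures
    (-1)^s = ((-1)^s)^k, so that l^k - (-1)^s r^k is a difference of k-th
    powers. *)
Lemma defect_exp s m n S T k A :
  (s -> odd k) ->
  defect s m n S T A = 0 -> defect s m n (S ^+ k) (T ^+ k) A = 0.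
Proof.
move=> sk; set l := lmul S; set r := rmul T.
have lr : GRing.comm l r by exact: comm_lmul_rmul.
have rl := commr_sym lr.
have rsr : GRing.comm r ((-1) ^+ s * r) by apply: commrM; [exact: commr_sign|].
have lsr : GRing.comm l ((-1) ^+ s * r) by apply: commrM; [exact: commr_sign|].
apply: (@defect_factor _ _ _ _ _ _ _ (\sum_(i < k) (l * r) ^+ i)
  (\sum_(i < k) l ^+ (k.-1 - i) * ((-1) ^+ s * r) ^+ i)).
- by apply/commr_sym/commr_sum => i _; apply/commrX/commrM.
- by apply/commr_sym/commr_sum => i _; apply/commrX/commrM.
- by apply/commr_sym/commr_sum => i _; apply: commrM; apply: commrX.
- by apply/commr_sym/commr_sum => i _; apply: commrM; apply: commrX.
- rewrite /iso_factor lmulX rmulX -exprMn_comm // subrX1.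
  apply/esym/commr_sym/commr_sum => i _; apply: commrX.
  by apply/commr_sym/commrB => //; exact: commr1.
rewrite /sym_factor lmulX rmulX.
have -> : (-1) ^+ s * rmul T ^+ k = ((-1) ^+ s * r) ^+ k.
  rewrite exprMn_comm; last exact/commr_sym/commr_sign.
  rewrite -exprM mulnC; congr (_ * _).
  case: s sk {rsr lsr} => [/(_ isT) k_odd|_]; last by rewrite muln0.
  by rewrite muln1 -(signr_odd _ k) k_odd.
rewrite subrXX_comm //.
apply/esym/commr_sym/commr_sum => i _; apply: commrM; apply: commrX.
  by apply/commr_sym/commrB.
by apply/commr_sym/commrB => //; apply/commr_sym.
Qed.

Lemma iso_factorX_E m S T A :
  (iso_factor S T ^+ m) A =
  \sum_(j < m.+1) (-1) ^+ (m - j) * (S ^+ j * A * T ^+ j) *+ 'C(m, j).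
Proof.
rewrite /iso_factor addrC exprDn_comm; last exact/commr_sym/commrN1.
rewrite addEnd_sum; apply: eq_bigr => j _; rewrite addEndMn addEnd_signM.
rewrite exprMn_comm; last exact: comm_lmul_rmul.
by rewrite -lmulX -rmulX addEndM /= mulrA.
Qed.

Lemma sym_factorX_E s n S T A :
  (sym_factor s S T ^+ n) A =
  \sum_(k < n.+1)
    (- (-1) ^+ s) ^+ (n - k) * (S ^+ k * A * T ^+ (n - k)) *+ 'C(n, k).
Proof.
rewrite /sym_factor addrC -mulNr exprDn_comm; last first.
  apply/commr_sym/commrM; last exact: comm_lmul_rmul.
  exact/commrN/commr_sign.
rewrite addEnd_sum; apply: eq_bigr => k _; rewrite addEndMn.
have eN (W : pzRingType) : (- (-1) ^+ s : W) = (-1) ^+ s.+1.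
  by rewrite exprS mulN1r.
rewrite !eN exprMn_comm; last exact/commr_sym/commr_sign.
rewrite -!exprM -mulrA addEnd_signM -rmulX -lmulX.
by rewrite -comm_lmul_rmul /= mulrA.
Qed.

End DefectOperators.

(** * Isosymmetric operators *)

Section IsosymmetricOperators.
Variables (R : realType) (H : hilbertType R).
Implicit Types A S T : bop H.

Lemma adjointM S T : adjoint (S * T) = adjoint T * adjoint S.
Proof.
apply/esym/adjoint_unique => x y.
by rewrite !bopME (adjointP S) (adjointP T).
Qed.

Lemma adjoint1 : adjoint (1 : bop H) = 1.
Proof. by apply/esym/adjoint_unique. Qed.

Lemma adjointX T k : adjoint (T ^+ k) = adjoint T ^+ k.
Proof.
by elim: k => [|k IHk]; rewrite ?adjoint1 // exprSr exprS adjointM IHk.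
Qed.

Lemma isosymm_sumE m n A T :
  isosymm_sum m n A T = defect false m n (adjoint T) T A.
Proof. by rewrite /defect addEndM iso_factorX_E sym_factorX_E. Qed.

Lemma skew_isosymm_sumE m n A T :
  skew_isosymm_sum m n A T = defect true m n (adjoint T) T A.
Proof.
rewrite /defect addEndM iso_factorX_E sym_factorX_E.
rewrite /skew_isosymm_sum; suff -> : skew_symm_sum n A T =
  \sum_(k < n.+1) (- (-1) ^+ true) ^+ (n - k) *
    (adjoint T ^+ k * A * T ^+ (n - k)) *+ 'C(n, k) by [].
by apply: eq_bigr => k _; rewrite expr1 opprK expr1n mul1r.
Qed.

Lemma defect_adjoint_inv s m n A T U :
  is_inverse T U ->
  defect s m n (adjoint T) T A = 0 <-> defect s m n (adjoint U) U A = 0.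
Proof.
case=> TU UT.
have TU' : adjoint T * adjoint U = 1 by rewrite -adjointM UT adjoint1.
have UT' : adjoint U * adjoint T = 1 by rewrite -adjointM TU adjoint1.
by split; apply: defect_inv.
Qed.

End IsosymmetricOperators.

Theorem theorem2p4 (R : realType) (H : hilbertType R)
    (H_separable : separable_space H) (T A : bop H)
    (A_positive : positive_operator A) (m n : nat) :
  [/\ forall Tinv : bop H, is_inverse T Tinv ->
        (isosymmetric A m n T <-> isosymmetric A m n Tinv) /\
        (skew_isosymmetric A m n T <-> skew_isosymmetric A m n Tinv),
      isosymmetric A m n T ->
        forall k : nat, isosymmetric A m n (T ^+ k)
    & skew_isosymmetric A m n T ->
        forall k : nat, odd k -> skew_isosymmetric A m n (T ^+ k)].
Proof.
rewrite /isosymmetric /skew_isosymmetric; split.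
- move=> U TU; rewrite !isosymm_sumE !skew_isosymm_sumE.
  by split; exact: defect_adjoint_inv.
- by move=> + k; rewrite !isosymm_sumE adjointX; exact: defect_exp.
- move=> + k k_odd; rewrite !skew_isosymm_sumE adjointX.
  exact: defect_exp.
Qed.
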